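(* Let $(u,\beta)$ be a solution to double-obstacle Allen--Cahn (AC) flow on an interval $T$. Then for a.e. $t\in T$, $$\frac{d}{dt}\,\mathrm{GL}_\varepsilon(u(t))\le0 .$$
   Context: Let $G=(V,E)$ be a finite, undirected, simple, connected graph with symmetric weights $\omega_{ij}=\omega_{ji}$, $\omega_{ij}>0$ for $ij\in E$ and $\omega_{ij}=0$ for $ij\notin E$. Let $d_i=\sum_{j}\omega_{ij}>0$ be the degree of $i\in V$. Fix $r\in[0,1]$ and $\varepsilon>0$. Let $\mathcal V=\{u:V\to\mathbb R\}$ and, for $X\subseteq\mathbb R$, $\mathcal V_X=\{u:V\to X\}$; $\mathcal V$ carries the inner product $\langle u,v\rangle_{\mathcal V}=\sum_{i\in V}u_iv_id_i^r$. Let $\mathcal E=\{\varphi:E\to\mathbb R\mid\varphi_{ij}=-\varphi_{ji}\}$ with $\langle\varphi,\phi\rangle_{\mathcal E}=\frac12\sum_{i,j\in V}\varphi_{ij}\phi_{ij}\omega_{ij}$ and induced norm $\|\cdot\|_{\mathcal E}$. $\mathbf 1\in\mathcal V$ is the constant function $1$. The graph gradient is $(\nabla u)_{ij}=u_j-u_i$ for $ij\in E$ (and $0$ otherwise), and the graph Laplacian is $(\Delta u)_i=d_i^{-r}\sum_{j\in V}\omega_{ij}(u_i-u_j)$. The double-obstacle potential is $W(x)=\frac12x(1-x)$ for $0\le x\le1$ and $W(x)=\infty$ otherwise. The graph Ginzburg--Landau functional is $\mathrm{GL}_\varepsilon(u)=\frac12\|\nabla u\|_{\mathcal E}^2+\frac1\varepsilon\langle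 W\circ u,\mathbf 1\rangle_{\mathcal V}$. For an open interval $T$, $H^1(T;\mathcal V)$ is the set of $u\in L^2(T;\mathcal V)$ with generalised (weak) time derivative $du/dt\in L^2(T;\mathcal V)$. For any interval $T$, $H^1_{loc}(T;\mathcal V)$ is the set of $u:T\to\mathcal V$ with $u\in H^1((a,b);\mathcal V)$ for all $a,b\in T$ with $a<b$. For $u\in\mathcal V_{[0,1]}$, $\mathcal B(u)$ is the set of $\alpha\in\mathcal V$ such that for each $i\in V$: $\alpha_i\ge0$ if $u_i=0$, $\alpha_i=0$ if $0<u_i<1$, and $\alpha_i\le0$ if $u_i=1$. A pair $(u,\beta)$ with $u:T\to\mathcal V_{[0,1]}$, $\beta:T\to\mathcal V$ is a solution to double-obstacle AC flow on an interval $T$ if $u\in H^1_{loc}(T;\mathcal V)\cap C^0(T;\mathcal V)$ and for a.e. $t\in T$, $\varepsilon\frac{du}{dt}+\varepsilon\Delta u(t)+\frac12\mathbf 1-u(t)=\beta(t)$ and $\beta(t)\in\mathcal B(u(t))$. *)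

(* Defs.v *)
From HB Require Import structures.
From mathcomp Require Import all_boot all_order all_algebra.
From mathcomp Require Import all_classical all_reals all_analysis.

Set Implicit Arguments.
Unset Strict Implicit.
Unset Printing Implicit Defensive.

Import Order.TTheory GRing.Theory Num.Theory.
Import numFieldNormedType.Exports.

Local Open Scope classical_set_scope.
Local Open Scope ring_scope.

Record wgraph (R : realType) (V : finType) := WGraph {
  edge : rel V;
  weight : V -> V -> R;
  edge_sym : symmetric edge;
  edge_irr : irreflexive edge;
  edge_connected : (0 < #|V|)%N /\ forall i j, connect edge i j;
  weight_sym : forall i j, weight i j = weight j i;
  weight_gt0 : forall i j, edge i j -> 0 < weight i j;
  weight_eq0 : forall i j, ~~ edge i j -> weight i j = 0;
  (* excludes the graph with a single vertex *)
  degree_gt0 : forall i, 0 < \sum_j weight i j }.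

Section Graph.
Variables (R : realType) (V : finType) (G : wgraph R V) (r eps : R).
Implicit Types (u v a : V -> R) (f g : V -> V -> R).

Definition degree (i : V) : R := \sum_j weight G i j.

Definition functions_into (X : set R) : set (V -> R) :=
  [set u | forall i, X (u i)].

Definition innerV u v : R := \sum_i u i * v i * degree i `^ r.

(* Edge functions are extended by 0 to V * V. *)
Definition innerE f g : R :=
  2^-1 * \sum_i \sum_j f i j * g i j * weight G i j.

Definition normE f : R := Num.sqrt (innerE f f).

Definition grad u (i j : V) : R := if edge G i j then u j - u i else 0.

Definition laplacian u (i : V) : R :=
  degree i `^ (- r) * \sum_j weight G i j * (u i - u j).

Definition obstacle (x : R) : \bar R :=
  if 0 <= x <= 1 then (2^-1 * x * (1 - x))%:E else +oo%E.

(* The sum is the inner product of W \o u with 1, where W is the potential: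
   W is extended-real valued, so innerV does not apply to it. *)
Definition GL u : \bar R :=
  ((2^-1 * normE (grad u) ^+ 2)%:E
   + eps^-1%:E * \sum_i (obstacle (u i) * 1%:E * (degree i `^ r)%:E))%E.

Definition subdiff u : set (V -> R) :=
  [set a | forall i, [/\ u i = 0 -> 0 <= a i,
                         0 < u i < 1 -> a i = 0 &
                         u i = 1 -> a i <= 0]].

End Graph.

Section Flow.
Variables (R : realType) (V : finType) (G : wgraph R V) (r eps : R).
Implicit Types (u v phi : R -> V -> R) (I : set R) (T : interval R).

Local Notation mu := (@lebesgue_measure R).

(* Functions of time are total; only their values on the time interval under
   consideration matter. *)

Definition L2 I u : Prop :=
  (forall i, measurable_fun I (fun t => u t i)) /\
  mu.-integrable I (fun t => (innerV G r (u t) (u t))%:E).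

(* smooth V-valued functions with compact support in the open set I *)
Definition test_function I phi : Prop :=
  [/\ forall i n t, derivable (derive1n n (fun s => phi s i)) t 1,
      compact (closure [set t | exists i, phi t i != 0]) &
      closure [set t | exists i, phi t i != 0] `<=` I].

Definition weak_derivative I u v : Prop :=
  forall phi, test_function I phi ->
    \int[mu]_(t in I) innerV G r (u t) (fun i => derive1 (fun s => phi s i) t)
    = - \int[mu]_(t in I) innerV G r (v t) (phi t).

Definition H1 I u : Prop :=
  L2 I u /\ exists2 v, L2 I v & weak_derivative I u v.

Definition H1loc T u : Prop :=
  forall a b, a \in T -> b \in T -> a < b -> H1 `]a, b[%classic u.

(* v is the weak derivative du/dt on T of u in H1loc T *)
Definition weak_derivative_loc T u v : Prop :=
  forall a b, a \in T -> b \in T -> a < b ->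
    L2 `]a, b[%classic v /\ weak_derivative `]a, b[%classic u v.

(* V is finite, so continuity into the functions on V is componentwise. *)
Definition C0 T u : Prop :=
  forall i, {within [set` T], continuous (fun t => u t i)}.

Definition AC_solution T (u beta : R -> V -> R) : Prop :=
  [/\ forall t, t \in T -> functions_into `[0, 1]%classic (u t),
      H1loc T u,
      C0 T u &
      exists2 du, weak_derivative_loc T u du &
        {ae mu, forall t, t \in T ->
           (forall i, eps * du t i + eps * laplacian G r (u t) i
                      + 2^-1 - u t i = beta t i) /\
           subdiff (u t) (beta t)}].

End Flow.

(* Classical differentiability at t of an extended-real valued function: it is
   required to be finite near t, so that fine does not hide infinite values. *)
Definition ederivable (R : realType) (f : R -> \bar R) (t : R) : Prop :=
  (\forall s \near t, f s \is a fin_num) /\ derivable (fine \o f) t 1.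

Definition ederive (R : realType) (f : R -> \bar R) (t : R) : R :=
  derive1 (fine \o f) t.

(* Main.v *)
Require Import Defs.
From mathcomp Require Import all_boot all_order all_algebra.
From mathcomp Require Import all_classical all_reals all_analysis.
From mathcomp Require Import measurable_realfun ring lra.
Import Order.TTheory GRing.Theory Num.Theory.
Import numFieldNormedType.Exports.

(** At almost every time the weak derivative of the flow is its classical
    derivative, and there the claim is the chain rule.  With [p] the velocity
    at such a time,
      d/dt GL(u) = sum_i d_i^r p_i ((Delta u)_i + (1/2 - u_i)/eps)
                 = sum_i d_i^r (p_i beta_i / eps - p_i^2)
    by the flow equation.  A coordinate sitting on an obstacle cannot have
    entered the obstacle from outside [0, 1]: if u_i = 0 then u_i >= 0 just
    before, so p_i <= 0, while beta_i >= 0; symmetrically at u_i = 1; and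
    beta_i = 0 strictly between the obstacles.  So p_i beta_i <= 0 and the
    energy cannot increase ([GL_dissipation]).  Since u stays in [0, 1], the
    energy is finite at all times of T and coincides with a quadratic
    polynomial in u, so that the chain rule is elementary
    ([is_derive_GL_real]).

    The analytic content is that a continuous function with an integrable weak
    derivative v is differentiable almost everywhere with derivative v
    ([weak_derivative_ae_is_derive]).  To see this, test the weak identity
    against phi_n(x) = h(n(x - s)) - h(n(x - t)), where h is a smooth step from
    0 to 1 on [0, 1].  The derivative of phi_n is a difference of two
    mollifiers concentrating at s and at t, so the left-hand side tends to
    u(s) - u(t) by continuity; phi_n tends to the indicator of ]s, t], so the
    right-hand side tends to minus the integral of v over ]s, t] by dominated
    convergence ([weak_derivative_increment]).  Thus u is a primitive of v up
    to a constant, and Lebesgue differentiation concludes.  The step h is the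
    normalised primitive of exp(-1/(x(1 - x))) extended by 0
    ([smooth_step_exists]).

    The weak derivative is only given on the intervals with end points in T;
    those with rational end points are countably many and cover T up to its
    end points, so almost-everywhere statements patch together
    ([ae_interval]). *)

Set Implicit Arguments.
Unset Strict Implicit.
Unset Printing Implicit Defensive.
Local Open Scope classical_set_scope.
Local Open Scope ring_scope.

(** * A smooth step function *)

Section SmoothStep.
Variable R : realType.
Implicit Types (f : R -> R) (q : {poly R}) (x y : R).

Lemma is_derive_quadratic f (C x : R) :
  (forall y, `|f y| <= C * (y - x) ^+ 2) -> is_derive x 1 f 0.
Proof.
move=> fC.
have fx0 : f x = 0.
  by apply/eqP; rewrite -normr_le0 (le_trans (fC x))// subrr expr0n mulr0.
have lim0 : h^-1 *: ((f \o shift x) (h *: 1) - f x) @[h --> 0^'] --> (0 : R).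
  apply: norm_cvg0.
  have C0 : (C *: (`|h| : R)) @[h --> (0:R)^'] --> (0:R).
    rewrite -[X in _ --> X](scaler0 _ C); apply: cvgZr.
    rewrite -[X in _ --> X](@normr0 _ R).
    apply: cvg_norm; exact: nbhs_dnbhs.
  apply: (squeeze_cvgr _ (cvg_cst 0) C0); near=> h.
  have h0 : h != 0 by near: h; exact: nbhs_dnbhs_neq.
  rewrite normr_ge0/= fx0 subr0 /GRing.scale /= mulr1 normrM normfV.
  rewrite ler_pdivrMl ?normr_gt0//.
  apply: (le_trans (fC _)); rewrite addrK -real_normK ?num_real// expr2.
  by rewrite mulrA mulrC.
by apply: DeriveDef; [apply/cvg_ex; exists 0 | exact: (cvg_lim _ lim0)].
Unshelve. all: by end_near. Qed.

(** The polynomial [q] and the exponent [k] are there to make the family stable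
    under differentiation, so that smoothness is a single induction. *)
Definition bump q (k : nat) x : R :=
  if 0 < x < 1 then
    q.[x] * (x * (1 - x))^-1 ^+ k * expR (- (x * (1 - x))^-1)
  else 0.

(** With w = x (1 - x), differentiating q w^-k exp(-1/w) and factoring out
    w^-(k+2) exp(-1/w) leaves q' w^2 + q w' (1 - k w), where w' = 1 - 2 x. *)
Definition bump_deriv_coef q (k : nat) : {poly R} :=
  q^`() * ('X * (1 - 'X)) ^+ 2
  + q * (1 - 2 *: 'X) * (1 - k%:R *: ('X * (1 - 'X))).

(** The bound that makes [bump] differentiable, with derivative 0, at every
    point [x] outside ]0, 1[, the end points included: exp(-1/w) beats every
    power of 1/w, so [bump] is O(w^2), and w is at most the distance from [y]
    to such an [x]. *)
Lemma bump_quadratic q k : exists C, forall x y,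
  ~~ (0 < x < 1) -> `|bump q k y| <= C * (y - x) ^+ 2.
Proof.
have cq : {within `[0, 1], continuous (fun z => `|q.[z]|)}.
  apply: continuous_subspaceT => z; apply: continuous_comp.
    exact: continuous_horner.
  exact: norm_continuous.
have [c _ cmax] := @EVT_max R _ 0 1 ler01 cq.
exists (`|q.[c]| * (k.+2)`!%:R) => x y xN.
rewrite /bump; case: ifPn => [/andP[y0 y1]|_]; last first.
  by rewrite normr0 mulr_ge0 ?sqr_ge0 ?mulr_ge0.
have w0 : 0 < y * (1 - y) by rewrite mulr_gt0// subr_gt0.
have wle : y * (1 - y) <= `|y - x|.
  move: xN; rewrite negb_and -!leNgt => /orP[x0|x1].
    rewrite ger0_norm; nra.
  rewrite ler0_norm; nra.
set w := y * (1 - y) in w0 wle *.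
rewrite !normrM (ger0_norm (expR_ge0 _)) -!mulrA ler_pM//.
- by apply: cmax; rewrite in_itv/= !ltW.
rewrite normrX ger0_norm ?invr_ge0 ?(ltW w0)// expRN.
(* one term of the exponential series, at 1/w *)
have e1 : w^-1 ^+ k.+2 <= k.+2`!%:R * expR w^-1.
  have := @expR_ge1Dxn R w^-1 k.+1; rewrite invr_ge0 ltW// => /(_ isT) h.
  rewrite -ler_pdivrMl ?ltr0n ?fact_gt0// mulrC (le_trans _ h)//.
  by rewrite lerDr ler01.
rewrite ler_pdivrMr ?expR_gt0//.
have -> : w^-1 ^+ k = w ^+ 2 * w^-1 ^+ k.+2.
  rewrite -[k.+2]addn2 exprD mulrC -mulrA (exprVn w 2) mulVf ?mulr1//.
  by rewrite expf_neq0// gt_eqF.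
apply: (le_trans (ler_wpM2l (sqr_ge0 w) e1)).
have w2 : w ^+ 2 <= (y - x) ^+ 2.
  by rewrite -[leRHS]real_normK ?num_real// lerXn2r ?nnegrE ?(ltW w0).
rewrite mulrCA mulrA; apply: ler_wpM2r; first exact: expR_ge0.
by rewrite ler_wpM2l.
Qed.

Lemma is_derive_bump q k x :
  is_derive x 1 (bump q k) (bump (bump_deriv_coef q k) k.+2 x).
Proof.
have [/andP[x0 x1]|xN] := boolP (0 < x < 1); last first.
  rewrite {2}/bump (negbTE xN).
  have [C qC] := bump_quadratic q k.
  by apply: (@is_derive_quadratic _ C) => y; exact: qC.
have w0 : x * (1 - x) != 0 by rewrite mulf_neq0 ?subr_eq0 ?gt_eqF.
have dw : is_derive x 1 (fun y : R => y * (1 - y)) (1 - 2 * x).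
  by apply: trigger_derive; rewrite /GRing.scale/=; ring.
have div := @is_deriveV R (fun y : R => y * (1 - y)) x _ _ w0 dw.
have dg : is_derive x 1 (horner q * (fun y : R => (y * (1 - y))^-1) ^+ k *
  (expR \o (- (fun y : R => (y * (1 - y))^-1))))
  (bump (bump_deriv_coef q k) k.+2 x).
  apply: is_derive_eq.
  rewrite /bump ifT; last by rewrite x0.
  have -> : (bump_deriv_coef q k).[x] = q^`().[x] * (x * (1 - x)) ^+ 2
      + q.[x] * (1 - 2 * x) * (1 - k%:R * (x * (1 - x))).
    by rewrite /bump_deriv_coef !(hornerE, horner_exp).
  rewrite !fctE -[k.+2]addn2 exprD -exprVn /GRing.scale/=.
  have : x * (1 - x) * (x * (1 - x))^-1 = 1 by rewrite divff.
  move: (x * (1 - x)) (x * (1 - x))^-1 => w iw wiw.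
  have -> : k%:R * iw ^+ k.-1 = k%:R * (iw ^+ k * w).
    by case: k => [|k]; rewrite ?mul0r// exprS mulrAC (mulrC iw) wiw mul1r.
  have iw0 : iw != 0.
    apply/eqP => iw0; move/eqP: wiw.
    by rewrite iw0 mulr0 eq_sym oner_eq0.
  have -> : w = iw^-1 by rewrite -[LHS](mulfK iw0) wiw div1r.
  move: (iw ^+ k) => A.
  by field.
apply: near_eq_is_derive dg.
near=> y; rewrite /bump.
have -> : 0 < y < 1.
  by apply/andP; split; near: y; [exact: lt_nbhsr|exact: lt_nbhsl].
by rewrite !fctE.
Unshelve. all: by end_near. Qed.

(** Infinite differentiability, in the form required of test functions. *)
Definition smooth f := forall n t, derivable (derive1n n f) t 1.

Lemma smooth_bump q k : smooth (bump q k).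
Proof.
move=> n; elim: n q k => [|n IHn] q k t.
  by have [] := is_derive_bump q k t.
rewrite derive1Sn (_ : derive1 (bump q k) = bump (bump_deriv_coef q k) k.+2).
  exact: IHn.
by apply/funext => x; rewrite derive1E; have [_ ->] := is_derive_bump q k x.
Qed.

Lemma continuous_bump q k : continuous (bump q k).
Proof.
move=> x; apply/differentiable_continuous/derivable1_diffP.
by have [] := is_derive_bump q k x.
Qed.

Lemma smooth_step_exists : exists h, [/\ smooth h,
  (forall x, x <= 0 -> h x = 0), (forall x, 1 <= x -> h x = 1) &
  (forall x, 0 <= derive1 h x)].
Proof.
pose rho : R -> R := bump 1 0.
have rhoE x : 0 < x < 1 -> rho x = expR (- (x * (1 - x))^-1).
  by move=> x01; rewrite /rho /bump x01 hornerC expr0 !mul1r.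
have rho0 x : ~~ (0 < x < 1) -> rho x = 0 by rewrite /rho /bump => /negbTE ->.
have rhoi u : (@lebesgue_measure R).-integrable `]-oo, u] (EFin \o rho).
  apply: (@integrableS _ _ _ _ setT) => //.
  have i01 : (@lebesgue_measure R).-integrable `[0, 1] (EFin \o rho).
    apply: continuous_compact_integrable; first exact: segment_compact.
    by apply: continuous_subspaceT; exact: continuous_bump.
  rewrite integrable_mkcond// in i01; move: i01.
  apply: eq_integrable => // x _; rewrite patchE; case: ifPn => //= xN.
  rewrite rho0//; apply: contra xN => /andP[x0 x1].
  by rewrite inE/= in_itv/= !ltW.
(* integrating from -oo makes H differentiable at all points alike *)
pose H x := (\int[lebesgue_measure]_(t in `]-oo, x]) rho t)%R.
have dH x : is_derive x 1 H (rho x).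
  have xx1 : x < x + 1 by rewrite ltrDl.
  have := @continuous_FTC1 R rho -oo%O x _ xx1 (rhoi _).
  rewrite ltNyr => /(_ isT (@continuous_bump _ _ x))[d1 d2].
  by apply: DeriveDef d1 _; rewrite -derive1E.
have cH : continuous H.
  move=> x; apply/differentiable_continuous/derivable1_diffP.
  by have [] := dH x.
have H0 x : x <= 0 -> H x = 0.
  move=> x0; rewrite /H (_ : \int[_]_(_ in _) _ =
      \int[lebesgue_measure]_(t in `]-oo, x]) (0 : R))%R.
    by rewrite Rintegral_cst// mul0r.
  apply: eq_Rintegral => t; rewrite inE/= in_itv/= => tx.
  by apply: rho0; rewrite negb_and -!leNgt (le_trans tx x0).
have H1 x : 1 <= x -> H x = H 1.
  rewrite le_eqVlt => /predU1P[<-//|x1].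
  have [] := @MVT R H rho 1 x x1 (fun y _ => dH y).
    by apply: continuous_subspaceT.
  move=> c; rewrite in_itv/= => /andP[c1 _] /eqP.
  rewrite rho0; last by rewrite negb_and -!leNgt (ltW c1) orbT.
  by rewrite mul0r subr_eq0 => /eqP.
have H1gt0 : 0 < H 1.
  rewrite -(H0 0)//; apply: (@gtr0_derive1_incr R H 0 1) => //.
  - move=> y; rewrite in_itv/= => y01; rewrite derive1E; have [_ ->] := dH y.
    by rewrite rhoE// expR_gt0.
  - by apply: continuous_subspaceT.
pose c := (H 1)^-1.
have dh x : is_derive x 1 (c \*: H) (bump c%:P 0 x).
  apply: is_derive_eq; rewrite /GRing.scale/=.
  have [x01|xN] := boolP (0 < x < 1); last first.
    by rewrite rho0// /bump (negbTE xN) mulr0.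
  by rewrite rhoE// /bump x01 hornerC expr0 mulr1.
have dhE : derive1 (c \*: H) = bump c%:P 0.
  by apply/funext => x; rewrite derive1E; have [_ ->] := dh x.
exists (c \*: H); split.
(* from the first derivative on, the derivatives of the step are bumps *)
- case=> [|n] t; first by have [] := dh t.
  by rewrite derive1Sn dhE; exact: smooth_bump.
- by move=> x x0; rewrite /= H0// scaler0.
- by move=> x x1; rewrite /= H1// /GRing.scale/= mulVf// gt_eqF.
- move=> x; rewrite dhE /bump; case: ifPn => // _.
  by rewrite hornerC expr0 mulr1 mulr_ge0 ?expR_ge0// invr_ge0 ltW.
Qed.
End SmoothStep.

(** * Weak derivatives of continuous functions *)

Section WeakDerivative.
Variable R : realType.
Implicit Types (f h : R -> R) (s t x d : R).
Notation mu := (@lebesgue_measure R).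

Lemma smooth_derivable f x : smooth f -> derivable f x 1.
Proof. by move=> /(_ 0%N x); rewrite derive1n0. Qed.

Lemma smoothB f h : smooth f -> smooth h -> smooth (f - h).
Proof.
move=> sf sh n.
have -> : derive1n n (f - h) = derive1n n f - derive1n n h.
  elim: n => // n IHn; rewrite !derive1nS IHn; apply/funext => x.
  by rewrite !fctE !derive1E deriveB.
by move=> t; exact: derivableB.
Qed.

Definition rescale h d s x := h (d^-1 * (x - s)).

Lemma is_derive_rescale h d s x : derivable h (d^-1 * (x - s)) 1 ->
  is_derive x 1 (rescale h d s) (d^-1 * derive1 h (d^-1 * (x - s))).
Proof.
move=> /derivableP dh.
have da : is_derive x 1 (fun y : R => d^-1 * (y - s)) d^-1.
  by apply: trigger_derive; rewrite /GRing.scale/=; ring.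
have := @is_derive1_comp R h (fun y : R => d^-1 * (y - s)) x _ _ dh da.
by rewrite derive1E mulrC.
Qed.

Lemma smooth_rescale h d s : smooth h -> smooth (rescale h d s).
Proof.
move=> sh n.
have -> : derive1n n (rescale h d s) = d^-1 ^+ n \*: rescale (derive1n n h) d s.
  elim: n => [|n IHn].
    by apply/funext => x /=; rewrite expr0 scale1r.
  rewrite derive1nS IHn; apply/funext => x /=.
  have [d1 d2] := is_derive_rescale (sh n (d^-1 * (x - s))).
  by rewrite derive1E deriveZ// d2 -derive1nS /GRing.scale/= mulrA exprSr.
move=> t; apply: derivableZ.
by have [] := is_derive_rescale (sh n (d^-1 * (t - s))).
Qed.

Section Step.
Variable h : R -> R.
Hypothesis smooth_h : smooth h.
Hypothesis h0 : forall x, x <= 0 -> h x = 0.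
Hypothesis h1 : forall x, 1 <= x -> h x = 1.
Hypothesis dh_ge0 : forall x, 0 <= derive1 h x.

Lemma smooth_continuous f : smooth f -> continuous f.
Proof.
move=> sf x.
exact/differentiable_continuous/derivable1_diffP/smooth_derivable.
Qed.

Lemma smooth_derive1 f : smooth f -> smooth (derive1 f).
Proof. by move=> sf n t; rewrite -derive1Sn; exact: sf. Qed.

Lemma step_itv01 x : 0 <= h x <= 1.
Proof.
have [x0|x0] := leP x 0; first by rewrite h0// lexx ler01.
have [x1|x1] := leP 1 x; first by rewrite h1// lexx ler01.
have ndec : {in `[0, 1] &, {homo h : y z / y <= z}}.
  apply: ger0_derive1_le_cc.
  - by move=> y _; exact: smooth_derivable.
  - by [].
  - exact/continuous_subspaceT/smooth_continuous.
rewrite -{1}(h0 (lexx 0)) -(h1 (lexx 1)).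
by rewrite !ndec ?in_itv/= ?lexx ?ler01 ?(ltW x0) ?(ltW x1).
Qed.

Lemma derive1_step_eq0 x : ~~ (0 <= x <= 1) -> derive1 h x = 0.
Proof.
rewrite derive1E negb_and -!ltNge => /orP[x0|x1].
  rewrite (@near_eq_derive _ _ _ h (cst 0)) ?derive_cst//.
  near=> y; apply/h0/ltW; near: y; exact: lt_nbhsl.
rewrite (@near_eq_derive _ _ _ h (cst 1)) ?derive_cst//.
near=> y; apply/h1/ltW; near: y; exact: lt_nbhsr.
Unshelve. all: by end_near. Qed.

Lemma rescale_near s x :
  \forall n \near \oo, rescale h n.+1%:R^-1 s x = (s < x)%R%:R.
Proof.
have [sx|xs] := ltP s x; last first.
  near=> n; rewrite /rescale invrK h0//.
  by rewrite mulr_ge0_le0// subr_le0.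
have xs0 : 0 < x - s by rewrite subr_gt0.
near=> n; rewrite /rescale h1// ler_pdivlMl// mulr1 ltW//.
near: n; exact: (near_infty_natSinv_lt (PosNum xs0)).
Unshelve. all: by end_near. Qed.

Lemma derive1_rescale d s x :
  derive1 (rescale h d s) x = d^-1 * derive1 h (d^-1 * (x - s)).
Proof.
rewrite derive1E.
have dh := @smooth_derivable h (d^-1 * (x - s)) smooth_h.
by have [_ ->] := is_derive_rescale dh.
Qed.

Lemma integrable_mul_smooth (a b : R) (u : R -> R) f :
  mu.-integrable `]a, b[ (EFin \o u) -> smooth f ->
  mu.-integrable `]a, b[ (EFin \o (u * f)).
Proof.
move=> iu /smooth_continuous cf.
have cnf : {within `[a, b], continuous (fun z => `|f z|)}.
  apply: continuous_subspaceT => z; apply: continuous_comp; first exact: cf.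
  exact: norm_continuous.
have [ba|ab] := leP b a.
  by rewrite set_itv_ge ?bnd_simp -?leNgt//; exact: integrable_set0.
have [c _ cmax] := EVT_max (ltW ab) cnf.
have -> : EFin \o (u * f) = ((EFin \o u) \* (EFin \o f))%E by apply/funext.
apply: integrableMl => //.
  by apply: measurable_funTS; exact: continuous_measurable_fun.
exists `|f c|; split; first exact: num_real.
move=> M cM x/=; rewrite in_itv/= => /andP[ax xb].
by apply: (le_trans _ (ltW cM)); rewrite cmax// in_itv/= !ltW.
Qed.

Lemma integral_derive1_rescale (a b : R) d s : 0 < d -> a < s -> s + d < b ->
  \int[mu]_(x in `]a, b[) derive1 (rescale h d s) x = 1.
Proof.
move=> d0 as_ sdb.
have sr := @smooth_rescale h d s smooth_h.
have ab : a < b by rewrite (lt_trans as_)// (lt_trans _ sdb)// ltrDl.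
have ck : continuous (derive1 (rescale h d s)).
  exact: smooth_continuous (smooth_derive1 sr).
have ik : mu.-integrable `[a, b] (EFin \o derive1 (rescale h d s)).
  apply: continuous_compact_integrable; first exact: segment_compact.
  exact: continuous_subspaceT.
rewrite Rintegral_itv_obnd_cbnd; last first.
  by apply: integrableS ik => //; exact: subset_itv_oo_cc.
rewrite Rintegral_itv_bndo_bndc; last first.
  by apply: integrableS ik => //; exact: subset_itv_co_cc.
rewrite /Rintegral (@continuous_FTC2 _ _ (rescale h d s))//.
- have ha : d^-1 * (a - s) <= 0.
    by rewrite mulr_ge0_le0 ?invr_ge0 ?subr_le0 ?ltW.
  have hb : 1 <= d^-1 * (b - s) by rewrite ler_pdivlMl// mulr1 lerBrDl ltW.
  by rewrite /rescale h1// h0//= subr0.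
- exact: continuous_subspaceT.
- split=> [x _||].
  + exact: smooth_derivable.
  + exact/cvg_at_right_filter/smooth_continuous.
  + exact/cvg_at_left_filter/smooth_continuous.
Qed.

(** The derivative of the rescaled step is nonnegative, supported in [s, s + d]
    and of integral 1, so integrating [u] against it averages [u] there. *)
Lemma mollify_le (a b : R) (u : R -> R) d s eta :
  mu.-integrable `]a, b[ (EFin \o u) -> 0 < d -> a < s -> s + d < b ->
  (forall x, s <= x <= s + d -> `|u x - u s| <= eta) ->
  `|\int[mu]_(x in `]a, b[) (u x * derive1 (rescale h d s) x) - u s| <= eta.
Proof.
move=> iu d0 as_ sdb ueta.
set k := derive1 (rescale h d s).
have sk : smooth k by exact/smooth_derive1/smooth_rescale.
have k_ge0 x : 0 <= k x by rewrite /k derive1_rescale mulr_ge0// invr_ge0 ltW.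
have kN x : ~~ (s <= x <= s + d) -> k x = 0.
  move=> xN; rewrite /k derive1_rescale derive1_step_eq0 ?mulr0//.
  apply: contra xN; rewrite pmulr_rge0 ?invr_gt0// ler_pdivrMl// mulr1.
  by rewrite subr_ge0 lerBlDl.
have ik : mu.-integrable `]a, b[ (EFin \o k).
  have ikc : mu.-integrable `[a, b] (EFin \o k).
    apply: continuous_compact_integrable; first exact: segment_compact.
    exact/continuous_subspaceT/smooth_continuous.
  by apply: integrableS ikc => //; exact: subset_itv_oo_cc.
have intk c : \int[mu]_(x in `]a, b[) (c * k x) = c.
  by rewrite RintegralZl// integral_derive1_rescale ?mulr1.
have iuk := integrable_mul_smooth iu sk.
have ick c : mu.-integrable `]a, b[ (EFin \o (fun x => c * k x)).
  by apply: eq_integrable (integrableZl _ c ik).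
have iB : mu.-integrable `]a, b[ (EFin \o (fun x => u x * k x - u s * k x)).
  by apply: eq_integrable (integrableB _ iuk (ick (u s))).
rewrite -[X in `|_ - X|](intk (u s)) -RintegralB// -[leRHS](intk eta).
apply: (le_trans (le_normr_Rintegral _ _)) => //.
apply: le_Rintegral => //.
  exact: integrable_norm.
move=> x _; rewrite -mulrBl normrM (ger0_norm (k_ge0 x)).
have [xs|/kN ->] := boolP (s <= x <= s + d); last by rewrite !mulr0.
by rewrite ler_wpM2r// ueta.
Qed.

Lemma mollify_cvg (a b : R) (u : R -> R) s :
  mu.-integrable `]a, b[ (EFin \o u) -> a < s < b -> {for s, continuous u} ->
  \int[mu]_(x in `]a, b[) (u x * derive1 (rescale h n.+1%:R^-1 s) x)
    @[n --> \oo] --> u s.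
Proof.
move=> iu /andP[as_ sb] cu; apply/cvgrPdist_le => e e0.
have /cvgrPdist_le/(_ e e0)[/= r r0 ur] := cu.
have m0 : 0 < Num.min r (b - s) by rewrite lt_min r0 subr_gt0.
near=> n.
have : n.+1%:R^-1 < Num.min r (b - s).
  near: n; exact: (near_infty_natSinv_lt (PosNum m0)).
rewrite lt_min => /andP[nr nb].
rewrite distrC; apply: mollify_le => //.
  by rewrite -ltrBrDl.
move=> x /andP[sx xs]; rewrite distrC; apply: ur => /=.
by rewrite ler0_norm ?subr_le0// opprB (le_lt_trans _ nr)// lerBlDl.
Unshelve. all: by end_near. Qed.

(** The test functions are differences, rather than products, of rescaled
    steps, so that their derivatives are differences of mollifiers. *)
Lemma weak_derivative_increment (a b : R) (u v : R -> R) s t :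
  mu.-integrable `]a, b[ (EFin \o u) -> mu.-integrable `]a, b[ (EFin \o v) ->
  {in `]a, b[, continuous u} ->
  (forall phi c d, smooth phi -> a < c -> d < b ->
    (forall x, ~~ (c <= x <= d) -> phi x = 0) ->
    \int[mu]_(x in `]a, b[) (u x * derive1 phi x) =
    - \int[mu]_(x in `]a, b[) (v x * phi x)) ->
  a < s -> s < t -> t < b ->
  u t - u s = \int[mu]_(x in `]s, t]) v x.
Proof.
move=> iu iv cu uv as_ st tb.
pose phi n : R -> R := rescale h n.+1%:R^-1 s - rescale h n.+1%:R^-1 t.
have sphi n : smooth (phi n) by apply: smoothB; exact: smooth_rescale.
have lhs : \int[mu]_(x in `]a, b[) (u x * derive1 (phi n) x) @[n --> \oo] -->
    u s - u t.
  have -> : (fun n => \int[mu]_(x in `]a, b[) (u x * derive1 (phi n) x)) =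
    (fun n => \int[mu]_(x in `]a, b[) (u x * derive1 (rescale h n.+1%:R^-1 s) x)
     - \int[mu]_(x in `]a, b[) (u x * derive1 (rescale h n.+1%:R^-1 t) x)).
    apply/funext => n; rewrite -RintegralB//.
    - apply: eq_Rintegral => x _; rewrite -mulrBr; congr (_ * _).
      rewrite !derive1E deriveB//; exact/smooth_derivable/smooth_rescale.
    - exact/(integrable_mul_smooth iu)/smooth_derive1/smooth_rescale.
    - exact/(integrable_mul_smooth iu)/smooth_derive1/smooth_rescale.
  apply: cvgB; apply: mollify_cvg => //.
  - by rewrite as_ (lt_trans st).
  - by apply: cu; rewrite in_itv/= as_ (lt_trans st).
  - by rewrite tb (lt_trans as_).
  - by apply: cu; rewrite in_itv/= tb (lt_trans as_).
have rhs : \int[mu]_(x in `]a, b[) (v x * phi n x) @[n --> \oo] -->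
    \int[mu]_(x in `]s, t]) v x.
  have st_ab : `]s, t] `<=` `]a, b[.
    move=> x /=; rewrite !in_itv/= => /andP[sx xt].
    by rewrite (lt_trans as_ sx) (le_lt_trans xt tb).
  have ivst : mu.-integrable `]a, b[ (EFin \o (v \_ `]s, t])).
    rewrite -restrict_EFin; apply/integrable_restrict => //.
    by rewrite setIidr//; exact: integrableS iv.
  have -> : \int[mu]_(x in `]s, t]) v x =
      \int[mu]_(x in `]a, b[) (v \_ `]s, t]) x.
    by rewrite -Rintegral_mkcondr setIidr.
  have ivphi n := integrable_mul_smooth iv (sphi n).
  (* at each x the rescaled steps are eventually equal to their limits *)
  have phi_cvg x : (v x * phi n x)%:E @[n --> \oo] --> (v \_ `]s, t] x)%:E.
    apply: cvg_near_cst; near=> n; congr (_%:E); rewrite /phi !fctE.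
    have -> : rescale h n.+1%:R^-1 s x = (s < x)%R%:R.
      by near: n; exact: rescale_near.
    have -> : rescale h n.+1%:R^-1 t x = (t < x)%R%:R.
      by near: n; exact: rescale_near.
    rewrite patchE mem_setE in_itv/= [t < x]ltNge.
    have [sx|xs] := ltP s x; have [xt|tx] := leP x t => /=.
    - by rewrite subr0 mulr1.
    - by rewrite subrr mulr0.
    - by rewrite subr0 mulr0.
    - by have := lt_trans (lt_le_trans tx xs) st; rewrite ltxx.
  have phi_le n x : (`|(v x * phi n x)%:E| <= (`|v x|)%:E)%E.
    rewrite lee_fin normrM ler_piMr// /phi !fctE /rescale.
    have /andP[A0 A1] := step_itv01 (n.+1%:R^-1^-1 * (x - s)).
    have /andP[B0 B1] := step_itv01 (n.+1%:R^-1^-1 * (x - t)).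
    by rewrite ler_norml; lra.
  have [_ _] := @dominated_convergence _ _ R mu `]a, b[ (measurable_itv _)
    (fun n => EFin \o (v * phi n)) (EFin \o (v \_ `]s, t]))
    (EFin \o (Num.norm \o v))
    (fun n => measurable_int _ (ivphi n)) (measurable_int _ ivst)
    (aeW mu (fun x _ => phi_cvg x))
    (integrable_norm iv) (aeW mu (fun x n _ => phi_le n x)).
  have <- : (\int[mu]_(x in `]a, b[) (v \_ `]s, t]) x)%:E =
      (\int[mu]_(x in `]a, b[) (EFin \o (v \_ `]s, t])) x)%E.
    by rewrite fineK//; exact: integrable_fin_num.
  by move=> /fine_cvg.
have eqn : \forall n \near \oo,
    \int[mu]_(x in `]a, b[) (u x * derive1 (phi n) x) =
    - \int[mu]_(x in `]a, b[) (v x * phi n x).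
  have tb0 : 0 < b - t by rewrite subr_gt0.
  near=> n; apply: (uv _ s (t + n.+1%:R^-1)) => //.
    rewrite -ltrBrDl; near: n; exact: (near_infty_natSinv_lt (PosNum tb0)).
  move=> x; rewrite negb_and -!ltNge /phi !fctE /rescale invrK => /orP[xs|tx].
    rewrite !h0 ?subrr// mulr_ge0_le0// subr_le0 ltW//.
    exact: lt_trans st.
  have xt : n.+1%:R^-1 <= x - t by rewrite lerBrDl ltW.
  have xs : n.+1%:R^-1 <= x - s by rewrite (le_trans xt)// lerB// ltW.
  by rewrite !h1 ?subrr// -ler_pdivrMl// mulr1.
have : u s - u t = - \int[mu]_(x in `]s, t]) v x.
  apply: (cvg_unique _ lhs) => //.
  apply: cvg_trans (cvgN rhs); apply: near_eq_cvg.
  by near do apply/esym.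
by move=> /eqP; rewrite -eqr_oppLR opprB => /eqP.
Unshelve. all: by end_near. Qed.

End Step.
End WeakDerivative.

Section WeakDerivativeAe.
Variable R : realType.
Notation mu := (@lebesgue_measure R).

(** On ]a, b[ the function [u] differs by a constant from the primitive [F] of
    [v], extended by 0, so differentiability of [F] at almost every point is
    inherited by [u]. *)
Lemma weak_derivative_ae_is_derive (a b : R) (u v : R -> R) :
  mu.-integrable `]a, b[ (EFin \o u) -> mu.-integrable `]a, b[ (EFin \o v) ->
  {in `]a, b[, continuous u} ->
  (forall phi c d, smooth phi -> a < c -> d < b ->
    (forall x, ~~ (c <= x <= d) -> phi x = 0) ->
    \int[mu]_(x in `]a, b[) (u x * derive1 phi x) =
    - \int[mu]_(x in `]a, b[) (v x * phi x)) ->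
  {ae mu, forall x, x \in `]a, b[ -> is_derive x 1 u (v x)}.
Proof.
move=> iu iv cu uv.
have [h [sh h0 h1 dh]] := smooth_step_exists R.
have incr s t : a < s -> s < t -> t < b ->
    u t - u s = \int[mu]_(x in `]s, t]) v x.
  exact: (weak_derivative_increment sh h0 h1 dh iu iv cu uv).
pose w := v \_ `]a, b[.
have iwT : mu.-integrable setT (EFin \o w).
  by rewrite /w -restrict_EFin -integrable_mkcond.
have iw y : mu.-integrable `]-oo, y] (EFin \o w) by apply: integrableS iwT.
have := FTC1Ny iw (integrable_locally (measurable_itv _) iv).
set F := fun x : R => _.
have incrF s t : a < s -> s < t -> t < b -> F t - F s = u t - u s.
  move=> as_ st tb; rewrite incr// /F Rintegral_itvB// ?bnd_simp ?ltW//.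
  apply: eq_Rintegral => x; rewrite inE/= in_itv/= => /andP[sx xt].
  rewrite /w patchE mem_set//= in_itv/=.
  by rewrite (lt_trans as_ sx) (le_lt_trans xt tb).
have uF c y : c \in `]a, b[ -> y \in `]a, b[ -> F y + (u c - F c) = u y.
  rewrite !in_itv/= => /andP[ac cb] /andP[ay yb].
  have [cy|yc|->] := ltgtP c y.
  - have := incrF c y ac cy yb; lra.
  - have := incrF y c ay yc cb; lra.
  - lra.
apply: filterS; first exact: (ae_filter_ringOfSetsType mu).
move=> x [dF F'x] xab.
have wx : w x = v x by rewrite /w patchE mem_set.
have dFx : is_derive x 1 F (v x) by apply: DeriveDef; rewrite // -derive1E F'x.
have dFu : is_derive x 1 (F + cst (u x - F x)) (v x).
  by apply: is_derive_eq; rewrite addr0.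
apply: near_eq_is_derive dFu.
move: (xab); rewrite in_itv/= => /andP[ax xb].
near=> y; apply: uF => //; rewrite in_itv/=; apply/andP; split; near: y.
  exact: lt_nbhsr.
exact: lt_nbhsl.
Unshelve. all: by end_near. Qed.
End WeakDerivativeAe.

(** * The energy along a differentiable flow *)

Section Pointwise.
Variables (R : realType) (V : finType).

Lemma is_derive_bigsum (f : V -> R -> R) (df : V -> R) (t : R) :
  (forall i, is_derive t 1 (f i) (df i)) ->
  is_derive t 1 (fun s => \sum_i f i s) (\sum_i df i).
Proof.
move=> dfi; elim: (index_enum V) => [|i l IHl].
  rewrite big_nil (_ : (fun s => _) = cst 0); first exact: is_derive_cst.
  by apply/funext => s; rewrite big_nil.
rewrite big_cons (_ : (fun s => _) = f i + (fun s => \sum_(j <- l) f j s)).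
  exact: is_deriveD.
by apply/funext => s; rewrite big_cons.
Qed.

(** Half of Fermat's rule, read off the difference quotients from the left.
    Differentiability is assumed at the minimum only, because the flow is
    differentiable at almost every time and possibly at no other. *)
Lemma is_derive_min_le0 (f : R -> R) (t p : R) : is_derive t 1 f p ->
  (\forall s \near t, f t <= f s) -> p <= 0.
Proof.
move=> [df <-] /nbhs_ballP[d /= d0 fd]; rewrite leNgt; apply/negP => p0.
have dfc : h^-1 *: ((f \o shift t) (h *: 1) - f t) @[h --> 0^'] --> 'D_1 f t.
  exact: df.
have [e /= e0 fe] := cvgr_gt _ dfc _ p0.
pose m := Num.min d e.
pose h := - (m / 2).
have m0 : 0 < m by rewrite lt_min d0 e0.
have hm : `|h| < m.
  by rewrite normrN gtr0_norm ?divr_gt0// gtr_pMr// invf_lt1// ltr1n.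
have hd : `|h| < d by rewrite (lt_le_trans hm)// ge_min lexx.
have he : `|h| < e by rewrite (lt_le_trans hm)// ge_min lexx orbT.
have h0 : h < 0 by rewrite /h oppr_lt0 divr_gt0.
have /(_ _ _)/= := fe h; rewrite sub0r normrN => /(_ he).
rewrite lt_eqF// => /(_ isT); apply/negP; rewrite -leNgt.
rewrite /GRing.scale/= mulr1 nmulr_rle0 ?invr_lt0// subr_ge0.
by apply: fd; rewrite /ball/= opprD addrCA subrr addr0 normrN.
Qed.

End Pointwise.

Section GinzburgLandau.
Variables (R : realType) (V : finType) (G : wgraph R V) (r eps : R).
Implicit Types u v p : V -> R.

Lemma degree_powR_gt0 i x : 0 < degree G i `^ x.
Proof. by rewrite powR_gt0// degree_gt0. Qed.

(** The Ginzburg-Landau energy of functions with values in [0, 1], as a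
    polynomial in their values.  The weight vanishes off the edges, so the
    gradient may be replaced by the difference u_j - u_i for all pairs. *)
Definition GL_real u : R :=
  4^-1 * (\sum_i \sum_j (u j - u i) ^+ 2 * weight G i j)
  + eps^-1 * (\sum_i 2^-1 * (u i * (1 - u i)) * degree G i `^ r).

Lemma GL_fin u : functions_into `[0, 1] u -> GL G r eps u = (GL_real u)%:E.
Proof.
move=> u01; rewrite /GL /GL_real EFinD; congr (_ + _)%E.
  have E : innerE G (grad G u) (grad G u) =
      2^-1 * \sum_i \sum_j (u j - u i) ^+ 2 * weight G i j.
    congr (_ * _); apply: eq_bigr => i _; apply: eq_bigr => j _.
    rewrite /grad; case: ifPn => [_|/weight_eq0 ->]; first by rewrite expr2.
    by rewrite !mulr0.
  rewrite /normE sqr_sqrtr E.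
    by rewrite mulrA; congr (_ * _)%:E; field.
  rewrite mulr_ge0// sumr_ge0// => i _; rewrite sumr_ge0// => j _.
  rewrite mulr_ge0 ?sqr_ge0//.
  by have [/weight_gt0/ltW//|/weight_eq0 ->] := boolP (edge G i j).
rewrite EFinM -sumEFin; congr (_ * _)%E; apply: eq_bigr => i _.
have := u01 i; rewrite /= in_itv/= => ui.
by rewrite /obstacle ui mule1 -EFinM mulrA.
Qed.

(** The first variation of the energy at [u] in the direction [p], in the form
    that it takes after Green's formula. *)
Definition GL_variation u p : R :=
  \sum_i degree G i `^ r * p i * (laplacian G r u i + eps^-1 * (2^-1 - u i)).

(** Discrete Green formula: by symmetry of the weights, the two terms of
    p_j - p_i contribute equally. *)
Lemma dirichlet_by_parts u p :
  2^-1 * (\sum_i \sum_j (u j - u i) * (p j - p i) * weight G i j) =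
  \sum_i degree G i `^ r * p i * laplacian G r u i.
Proof.
have -> : \sum_i \sum_j (u j - u i) * (p j - p i) * weight G i j =
   \sum_i \sum_j p i * (weight G i j * (u i - u j))
   + \sum_i \sum_j p i * (weight G i j * (u i - u j)).
  rewrite [X in _ = X + _]exchange_big -big_split/=; apply: eq_bigr => i _.
  rewrite -big_split/=; apply: eq_bigr => j _.
  by rewrite (weight_sym G j i); ring.
set S := \sum_i _; have -> : 2^-1 * (S + S) = S by field.
apply: eq_bigr => i _.
rewrite /laplacian mulrA -mulr_sumr; congr (_ * _).
by rewrite powRN mulrAC divff ?mul1r// gt_eqF// degree_powR_gt0.
Qed.

Lemma is_derive_GL_real (u : R -> V -> R) p (t : R) :
  (forall i, is_derive t 1 (fun s => u s i) (p i)) ->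
  is_derive t 1 (fun s => GL_real (u s)) (GL_variation (u t) p).
Proof.
move=> du.
have d1 i : is_derive t 1 (fun s => \sum_j (u s j - u s i) ^+ 2 * weight G i j)
    (2 * \sum_j (u t j - u t i) * (p j - p i) * weight G i j).
  rewrite mulr_sumr; apply: is_derive_bigsum => j.
  have -> : (fun s => (u s j - u s i) ^+ 2 * weight G i j) =
      ((u ^~ j) - (u ^~ i)) ^+ 2 * cst (weight G i j) by [].
  by apply: is_derive_eq; rewrite !fctE /GRing.scale/=; ring.
have d2 i : is_derive t 1
    (fun s => 2^-1 * (u s i * (1 - u s i)) * degree G i `^ r)
    (degree G i `^ r * p i * (2^-1 - u t i)).
  have -> : (fun s => 2^-1 * (u s i * (1 - u s i)) * degree G i `^ r) =
    cst 2^-1 * ((u ^~ i) * (cst 1 - (u ^~ i))) * cst (degree G i `^ r) by [].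
  by apply: is_derive_eq; rewrite !fctE /GRing.scale/=; field.
have D1 := is_derive_bigsum d1; have D2 := is_derive_bigsum d2.
have -> : (fun s => GL_real (u s)) =
  4^-1 \*: (fun s => \sum_i \sum_j (u s j - u s i) ^+ 2 * weight G i j)
  + eps^-1 \*:
    (fun s => \sum_i 2^-1 * (u s i * (1 - u s i)) * degree G i `^ r) by [].
apply: is_derive_eq.
rewrite -mulr_sumr /GRing.scale/= mulrA (_ : 4^-1 * 2 = 2^-1); last by field.
rewrite dirichlet_by_parts mulr_sumr -big_split/=; apply: eq_bigr => i _.
by rewrite [RHS]mulrDr; congr (_ + _); rewrite [RHS]mulrCA.
Qed.

(** By the flow equation each summand of the variation is
    d_i^r (p_i beta_i / eps - p_i^2). *)
Lemma GL_variation_le0 u p beta : 0 < eps ->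
  (forall i, eps * p i + eps * laplacian G r u i + 2^-1 - u i = beta i) ->
  (forall i, p i * beta i <= 0) -> GL_variation u p <= 0.
Proof.
move=> eps0 flow pbeta.
rewrite /GL_variation -oppr_ge0 -sumrN sumr_ge0// => i _.
have -> : - (degree G i `^ r * p i *
      (laplacian G r u i + eps^-1 * (2^-1 - u i))) =
    degree G i `^ r * (p i ^+ 2 - eps^-1 * (p i * beta i)).
  by rewrite -flow; field; rewrite gt_eqF.
rewrite mulr_ge0 ?(ltW (degree_powR_gt0 _ _))//.
by rewrite subr_ge0 (le_trans _ (sqr_ge0 _))// pmulr_rle0 ?invr_gt0.
Qed.

(** On the lower obstacle the velocity is nonpositive and the reaction
    [beta] nonnegative; on the upper one the signs are reversed; in between the
    reaction vanishes. *)
Lemma velocity_subdiff_le0 (u : R -> V -> R) p beta (t : R) :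
  (\forall s \near t, functions_into `[0, 1] (u s)) ->
  subdiff (u t) beta -> (forall i, is_derive t 1 (fun s => u s i) (p i)) ->
  forall i, p i * beta i <= 0.
Proof.
move=> u01 ub du i.
have : 0 <= u t i <= 1 by have := nbhs_singleton u01 i; rewrite /= in_itv.
have [b0 b01 b1] := ub i.
move=> /andP[]; rewrite le_eqVlt => /predU1P[u0 _|u0].
  apply: mulr_le0_ge0; last exact: b0.
  apply: (is_derive_min_le0 (du i)); near=> s.
  have : functions_into `[0, 1] (u s) by near: s.
  by move=> /(_ i); rewrite /= in_itv/= -u0 => /andP[].
rewrite le_eqVlt => /predU1P[u1|u1]; last by rewrite b01 ?mulr0// u0.
apply: mulr_ge0_le0; last exact: b1.
rewrite -oppr_le0.
apply: (@is_derive_min_le0 R (- (u ^~ i)) t).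
near=> s.
have : functions_into `[0, 1] (u s) by near: s.
by move=> /(_ i); rewrite /= in_itv/= !fctE u1 lerN2 => /andP[].
Unshelve. all: by end_near. Qed.

Lemma GL_dissipation (u : R -> V -> R) p beta (t : R) : 0 < eps ->
  (\forall s \near t, functions_into `[0, 1] (u s)) ->
  (forall i, is_derive t 1 (fun s => u s i) (p i)) ->
  (forall i, eps * p i + eps * laplacian G r (u t) i + 2^-1 - u t i = beta i) ->
  subdiff (u t) beta ->
  ederivable (fun s => GL G r eps (u s)) t /\
  ederive (fun s => GL G r eps (u s)) t <= 0.
Proof.
move=> eps0 u01 du flow ub.
have [d1 d2] : is_derive t 1 (fine \o (fun s => GL G r eps (u s)))
    (GL_variation (u t) p).
  apply: near_eq_is_derive (is_derive_GL_real du).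
  by apply: filterS u01 => s us; rewrite /= GL_fin.
split; first split => //.
  by apply: filterS u01 => s us; rewrite GL_fin.
rewrite /ederive derive1E d2; apply: GL_variation_le0 flow _ => //.
exact: (velocity_subdiff_le0 u01 ub du).
Qed.

End GinzburgLandau.

(** * From local to global almost-everywhere statements *)

Section Time.
Variable R : realType.
Notation mu := (@lebesgue_measure R).

Lemma ae_not_subsingleton (A : set R) :
  is_subset1 A -> {ae mu, forall t, ~ A t}.
Proof.
move=> A1.
have [->|/set0P[t At]] := eqVneq A set0; first by apply: aeW => t [].
exists [set t]; split => [||s /contrapT As].
- exact: measurable_set1.
- exact: lebesgue_measure_set1.
- exact: A1.
Qed.

(** Every point of [T] that is neither its minimum nor its maximum lies between
    two rational points of [T], and there are countably many such pairs. *)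
Lemma ae_interval (T : interval R) (P : R -> Prop) :
  (forall a b, a \in T -> b \in T -> a < b ->
    {ae mu, forall t, t \in `]a, b[ -> P t}) ->
  {ae mu, forall t, t \in T -> P t}.
Proof.
move=> aeP.
pose Q n t := if @unpickle (rat * rat)%type n is Some (p, q) then
  ratr p \in T -> ratr q \in T -> t \in `]ratr p, ratr q[ -> P t else True.
have aeQ : {ae mu, forall t, forall n, Q n t}.
  apply: ae_foralln => n; rewrite /Q.
  case: unpickle => [[p q]|]; last exact: aeW.
  have [pT|] := boolP (ratr p \in T); last by move=> _; exact: aeW.
  have [qT|] := boolP (ratr q \in T); last by move=> _; exact: aeW.
  have [pq|qp] := ltP (ratr p : R) (ratr q).
    apply: filterS (aeP _ _ pT qT pq).
      exact: (ae_filter_ringOfSetsType mu).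
    by move=> t Pt _ _; exact: Pt.
  apply: aeW => t _ _; rewrite in_itv/= => /andP[/lt_trans h /h].
  by rewrite ltNge qp.
have aemin : {ae mu, forall t, ~ (t \in T /\ forall s, s \in T -> t <= s)}.
  apply: ae_not_subsingleton => s t [sT sm] [tT tm].
  by apply/eqP; rewrite eq_le sm// tm.
have aemax : {ae mu, forall t, ~ (t \in T /\ forall s, s \in T -> s <= t)}.
  apply: ae_not_subsingleton => s t [sT sm] [tT tm].
  by apply/eqP; rewrite eq_le sm// tm.
have FF := ae_filter_ringOfSetsType mu.
apply: filterS3 aeQ aemin aemax => t Qt tmin tmax tT.
have [a aT at_] : exists2 a, a \in T & a < t.
  apply: contrapT => H; apply: tmin; split => // s sT; rewrite leNgt.
  by apply/negP => st; apply: H; exists s.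
have [b bT tb] : exists2 b, b \in T & t < b.
  apply: contrapT => H; apply: tmax; split => // s sT; rewrite leNgt.
  by apply/negP => st; apply: H; exists s.
have [p] := rat_in_itvoo at_; rewrite in_itv/= => /andP[ap pt].
have [q] := rat_in_itvoo tb; rewrite in_itv/= => /andP[tq qb].
have := Qt (pickle (p, q)); rewrite /Q pickleK; apply.
- by apply: (interval_is_interval aT tT); rewrite (ltW ap) (ltW pt).
- by apply: (interval_is_interval tT bT); rewrite (ltW tq) (ltW qb).
- by rewrite in_itv/= pt tq.
Qed.

End Time.

(** * The velocity of the flow *)

Section Flow.
Variables (R : realType) (V : finType) (G : wgraph R V) (r : R).
Notation mu := (@lebesgue_measure R).
Implicit Types (u v : R -> V -> R).

(** On a bounded interval |x| <= 1 + x^2 makes square-integrable functions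
    integrable. *)
Lemma L2_integrable (a b : R) u i : L2 G r `]a, b[%classic u ->
  mu.-integrable `]a, b[ (EFin \o (u ^~ i)).
Proof.
move=> [mu_u iu].
have dr0 := degree_powR_gt0 G i r.
pose g t := (1 + (degree G i `^ r)^-1 * innerV G r (u t) (u t))%R.
have ig : mu.-integrable `]a, b[ (EFin \o g).
  have i1 : mu.-integrable `]a, b[ (EFin \o cst (1 : R)).
    have cc : {within `[a, b], continuous (cst (1 : R))}.
      by apply: continuous_subspaceT => t; exact: cst_continuous.
    have := continuous_compact_integrable (@segment_compact R a b) cc.
    by apply: integrableS => //; exact: subset_itv_oo_cc.
  pose k := (degree G i `^ r)^-1.
  by apply: eq_integrable (integrableD _ i1 (integrableZl _ k iu)).
apply: le_integrable ig => //.
  by apply/measurable_EFinP; exact: mu_u.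
move=> t _ /=; rewrite lee_fin.
have le1 : u t i ^+ 2 <= (degree G i `^ r)^-1 * innerV G r (u t) (u t).
  rewrite ler_pdivlMl// mulrC /innerV (bigD1 i)//= -expr2 lerDl.
  rewrite sumr_ge0// => j _.
  by rewrite -expr2 mulr_ge0 ?sqr_ge0// ltW// degree_powR_gt0.
rewrite (le_trans _ (ler_norm _))// /g.
apply: le_trans (lerD (lexx 1) le1).
rewrite -(real_normK (num_real (u t i))); have := normr_ge0 (u t i); nra.
Qed.

(** A scalar test function placed in coordinate [i] isolates that coordinate;
    the factor d_i^r on both sides is positive and cancels. *)
Lemma weak_derivative_component (a b : R) u v i (phi : R -> R) (c d : R) :
  L2 G r `]a, b[%classic u -> L2 G r `]a, b[%classic v ->
  weak_derivative G r `]a, b[%classic u v ->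
  smooth phi -> a < c -> d < b ->
  (forall t, ~~ (c <= t <= d) -> phi t = 0) ->
  \int[mu]_(t in `]a, b[) (u t i * derive1 phi t) =
  - \int[mu]_(t in `]a, b[) (v t i * phi t).
Proof.
move=> /(L2_integrable i) iu /(L2_integrable i) iv uv sphi ac db phi0.
pose Phi t j := if j == i then phi t else 0.
have PhiE j : (fun t => Phi t j) = if j == i then phi else cst 0.
  by apply/funext => t; rewrite /Phi; case: eqP.
have cst0 n : derive1n n (cst (0 : R)) = cst (0 : R) :> (R -> R).
  elim: n => // n IHn; rewrite derive1nS IHn; apply/funext => t.
  by rewrite derive1_cst.
have supp : closure [set t | exists j, Phi t j != 0] `<=` `[c, d].
  rewrite [X in _ `<=` X](closure_id _).1; last exact: itv_closed.
  apply: closureS => t [j] /=; rewrite /Phi in_itv/=.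
  case: (j == i); last by rewrite eqxx.
  by apply: contraNT => /phi0 ->.
have test : test_function `]a, b[%classic Phi.
  split.
  - move=> j n t; rewrite PhiE; case: eqP => _; first exact: sphi.
    by rewrite cst0; exact: derivable_cst.
  - apply: subclosed_compact supp; first exact: closed_closure.
    exact: segment_compact.
  - apply: subset_trans supp _ => t /=; rewrite !in_itv/= => /andP[ct td].
    by rewrite (lt_le_trans ac ct) (le_lt_trans td db).
have inner (w : V -> R) (psi : V -> R) : (forall j, j != i -> psi j = 0) ->
    innerV G r w psi = w i * psi i * degree G i `^ r.
  move=> psi0; rewrite /innerV (bigD1 i)//= big1 ?addr0// => j ji.
  by rewrite psi0// mulr0 mul0r.
have dr0 := degree_powR_gt0 G i r.
have := uv _ test.
have -> : \int[mu]_(t in `]a, b[)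
      innerV G r (u t) (fun j => derive1 (fun s => Phi s j) t) =
    \int[mu]_(t in `]a, b[) (u t i * derive1 phi t * degree G i `^ r).
  apply: eq_Rintegral => t _; rewrite inner => [|j ji]; rewrite PhiE.
    by rewrite eqxx.
  by rewrite (negbTE ji) derive1_cst.
have -> : \int[mu]_(t in `]a, b[) innerV G r (v t) (Phi t) =
    \int[mu]_(t in `]a, b[) (v t i * phi t * degree G i `^ r).
  apply: eq_Rintegral => t _; rewrite inner /Phi ?eqxx// => j ji.
  by rewrite (negbTE ji).
rewrite RintegralZr//; last first.
  exact: (integrable_mul_smooth iu (smooth_derive1 sphi)).
rewrite RintegralZr//; last exact: (integrable_mul_smooth iv sphi).
by rewrite -mulNr; apply: mulIf; rewrite gt_eqF.
Qed.

Lemma H1loc_ae_is_derive (T : interval R) u du (a b : R) :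
  a \in T -> b \in T -> a < b ->
  H1loc G r T u -> C0 T u -> weak_derivative_loc G r T u du ->
  {ae mu, forall t, t \in `]a, b[ -> forall i, is_derive t 1 (u ^~ i) (du t i)}.
Proof.
move=> aT bT ab uH1 uC0 udu.
have [uL2 _] := uH1 a b aT bT ab.
have [duL2 wd] := udu a b aT bT ab.
have abT : `]a, b[%classic `<=` [set` T].
  move=> t /=; rewrite in_itv/= => /andP[at_ tb].
  by apply: (interval_is_interval aT bT); rewrite (ltW at_) (ltW tb).
have FF := ae_filter_ringOfSetsType mu.
have : {ae mu, forall t, forall i,
    t \in `]a, b[ -> is_derive t 1 (u ^~ i) (du t i)}.
  apply: filter_forall => i.
  apply: weak_derivative_ae_is_derive.
  - exact: L2_integrable uL2.
  - exact: L2_integrable duL2.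
  - have := continuous_subspaceW abT (uC0 i).
    rewrite continuous_open_subspace; last exact: interval_open.
    by move=> cu t tab; apply: cu; rewrite inE.
  - by move=> phi c d; exact: weak_derivative_component.
by apply: filterS => t dt tab i; exact: dt.
Qed.
End Flow.

(** * Dissipation of the Ginzburg-Landau energy *)

Theorem proposition3p9 (R : realType) (V : finType) (G : wgraph R V)
    (r eps : R) (hr : 0 <= r <= 1) (heps : 0 < eps)
    (T : interval R) (u beta : R -> V -> R)
    (hu : AC_solution G r eps T u beta) :
  {ae @lebesgue_measure R, forall t, t \in T ->
     ederivable (fun s => GL G r eps (u s)) t /\
     ederive (fun s => GL G r eps (u s)) t <= 0}.
Proof.
have [u01 uH1 uC0 [du udu flow]] := hu.
apply: ae_interval => a b aT bT ab.
have FF := ae_filter_ringOfSetsType (@lebesgue_measure R).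
apply: filterS2 (H1loc_ae_is_derive aT bT ab uH1 uC0 udu) flow.
move=> t dut flowt tab.
have abT s : s \in `]a, b[ -> s \in T.
  rewrite in_itv/= => /andP[as_ sb].
  by apply: (interval_is_interval aT bT); rewrite (ltW as_) (ltW sb).
have [eqt subt] := flowt (abT _ tab).
apply: (GL_dissipation heps _ (dut tab) eqt subt).
have /andP[at_ tb] : a < t < b by move: tab; rewrite in_itv.
near=> s; apply/u01/abT; rewrite in_itv/=; apply/andP; split; near: s.
  exact: lt_nbhsr.
exact: lt_nbhsl.
Unshelve. all: by end_near. Qed.
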